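(* The commutator subgroups $UB_3'$ and $UB_4'$ of the universal braid groups $UB_3$ and $UB_4$ are not finitely generated.
   Context: For $n\ge 3$, the universal braid group $UB_n$ is the group with $2(n-1)$ generators $\sigma_i,\rho_i$ ($1\le i\le n-1$) and the following defining relations (for all indices for which they make sense, i.e. all indices lie in $\{1,\dots,n-1\}$): $\sigma_i\sigma_j=\sigma_j\sigma_i$ if $|i-j|>1$; $\sigma_i\sigma_{i+1}\sigma_i=\sigma_{i+1}\sigma_i\sigma_{i+1}$; $\rho_i\rho_j=\rho_j\rho_i$ if $|i-j|>1$; $\sigma_i\rho_j=\rho_j\sigma_i$ if $|i-j|>1$. For a group $G$, $G'=[G,G]$ is the commutator subgroup, generated by all $x^{-1}y^{-1}xy$ with $x,y\in G$. *)

(* Defs.v *)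
From HB Require Import structures.
From mathcomp Require Import all_boot all_classical.
Set Implicit Arguments.
Unset Strict Implicit.
Unset Printing Implicit Defensive.
Local Open Scope classical_set_scope.
Local Open Scope group_scope.
Local Open Scope quotient_scope.

Section Subgroups.
Variable G : groupType.

Definition is_subgroup (H : set G) : Prop := group_closed (mem H).

Definition subgroup_gen (S : set G) : set G := smallest is_subgroup S.

Definition fin_gen (H : set G) : Prop :=
  exists2 S : set G, finite_set S & subgroup_gen S = H.

Definition commutator_subgroup : set G :=
  subgroup_gen [set [~ x, y] | x in [set: G] & y in [set: G]].

End Subgroups.

Arguments commutator_subgroup : clear implicits.

(* Words in the letters x^{+1}, x^{-1}: (x, false) stands for x and (x, true)
   for its formal inverse. *)
Definition word (X : choiceType) := seq (X * bool).

Section Presentation.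
Variables (X : choiceType) (R : word X -> word X -> Prop).
Implicit Types u v w : word X.

(* The least congruence on words containing R (each R u v being a defining
   relation u = v) and making the two letters of each generator inverse. *)
Inductive pres_cong : word X -> word X -> Prop :=
| pres_rel u v : R u v -> pres_cong u v
| pres_inv x b : pres_cong [:: (x, b); (x, ~~ b)] [::]
| pres_cat u u' v v' :
    pres_cong u u' -> pres_cong v v' -> pres_cong (u ++ v) (u' ++ v')
| pres_refl u : pres_cong u u
| pres_sym u v : pres_cong u v -> pres_cong v u
| pres_trans v u w : pres_cong u v -> pres_cong v w -> pres_cong u w.

Definition pres_eqb : rel (word X) := fun u v => `[< pres_cong u v >].

Lemma pres_eqb_refl : reflexive pres_eqb.
Proof. by move=> u; apply/asboolP; apply: pres_refl. Qed.

Lemma pres_eqb_sym : symmetric pres_eqb.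
Proof. by move=> u v; apply/asboolP/asboolP; apply: pres_sym. Qed.

Lemma pres_eqb_trans : transitive pres_eqb.
Proof. by move=> v u w /asboolP uv /asboolP vw; apply/asboolP/(pres_trans uv). Qed.

Canonical pres_equiv := EquivRel pres_eqb pres_eqb_refl pres_eqb_sym pres_eqb_trans.

Definition pres_group := {eq_quot pres_equiv}.

HB.instance Definition _ := Choice.on pres_group.
HB.instance Definition _ := EqQuotient.on pres_group.

Definition pres_class (u : word X) : pres_group := \pi_pres_group u.

Lemma pres_classK (a : pres_group) : pres_class (repr a) = a.
Proof. exact: (@reprK _ pres_group). Qed.

Lemma pres_classP u v : pres_class u = pres_class v <-> pres_cong u v.
Proof.
split; first by move/eqmodP => /= /asboolP.
by move=> uv; apply/eqmodP => /=; apply/asboolP.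
Qed.

Definition word_inv (u : word X) : word X := rev [seq (l.1, ~~ l.2) | l <- u].

Lemma word_invK : involutive word_inv.
Proof.
move=> u; rewrite /word_inv map_rev revK -map_comp -[RHS]map_id.
by apply: eq_map => -[x b] /=; rewrite negbK.
Qed.

Lemma pres_mulwV u : pres_cong (u ++ word_inv u) [::].
Proof.
elim: u => [|[x b] u IHu]; first exact: pres_refl.
rewrite /word_inv /= rev_cons -cats1 catA -/(word_inv u) -cat1s.
apply: pres_trans (pres_inv x b).
rewrite -[[:: (x, b); _]]/([:: (x, b)] ++ ([::] ++ [:: (x, ~~ b)])).
by apply: pres_cat (pres_refl _) (pres_cat _ (pres_refl _)).
Qed.

Lemma pres_mulVw u : pres_cong (word_inv u ++ u) [::].
Proof. by rewrite -{2}[u]word_invK; apply: pres_mulwV. Qed.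

Lemma pres_cong_inv u v : pres_cong u v -> pres_cong (word_inv u) (word_inv v).
Proof.
move=> uv; apply: (@pres_trans (word_inv u ++ v ++ word_inv v)).
  rewrite -{1}[word_inv u]cats0; apply: pres_cat (pres_refl _) _.
  exact/pres_sym/pres_mulwV.
rewrite catA -[X in pres_cong _ X]cat0s; apply: pres_cat (pres_refl _).
apply: pres_trans (pres_mulVw u).
exact: pres_cat (pres_refl _) (pres_sym uv).
Qed.

Definition pres_one : pres_group := pres_class [::].
Definition pres_mul (a b : pres_group) : pres_group := pres_class (repr a ++ repr b).
Definition pres_invg (a : pres_group) : pres_group := pres_class (word_inv (repr a)).

Lemma pres_repr u : pres_cong (repr (pres_class u)) u.
Proof. by apply/pres_classP; rewrite pres_classK. Qed.

Lemma pres_mulE u v : pres_mul (pres_class u) (pres_class v) = pres_class (u ++ v).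
Proof. by apply/pres_classP/pres_cat; apply: pres_repr. Qed.

Lemma pres_invgE u : pres_invg (pres_class u) = pres_class (word_inv u).
Proof. exact/pres_classP/pres_cong_inv/pres_repr. Qed.

Lemma pres_mulA : associative pres_mul.
Proof.
move=> a b c; rewrite -[a]pres_classK -[b]pres_classK -[c]pres_classK.
by rewrite !pres_mulE catA.
Qed.

Lemma pres_mul1 : left_id pres_one pres_mul.
Proof. by move=> a; rewrite -[a]pres_classK pres_mulE. Qed.

Lemma pres_mulr1 : right_id pres_one pres_mul.
Proof. by move=> a; rewrite -[a]pres_classK pres_mulE cats0. Qed.

Lemma pres_mulV : left_inverse pres_one pres_invg pres_mul.
Proof.
by move=> a; rewrite -[a]pres_classK pres_invgE pres_mulE; apply/pres_classP/pres_mulVw.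
Qed.

Lemma pres_mulrV : right_inverse pres_one pres_invg pres_mul.
Proof.
by move=> a; rewrite -[a]pres_classK pres_invgE pres_mulE; apply/pres_classP/pres_mulwV.
Qed.

HB.instance Definition _ := isGroup.Build pres_group
  pres_mulA pres_mul1 pres_mulr1 pres_mulV pres_mulrV.

End Presentation.

(* The generators of UB_n are inl i and inr i, i < n - 1; indices are shifted
   to start at 0, so that inl i is sigma_(i+1) and inr i is rho_(i+1). *)
Definition ub_gen (n : nat) : choiceType := ('I_n.-1 + 'I_n.-1)%type.

Definition sigma (n : nat) (i : 'I_n.-1) : ub_gen n * bool := (inl i, false).
Definition rho (n : nat) (i : 'I_n.-1) : ub_gen n * bool := (inr i, false).

(* |i - j| > 1 *)
Definition far (n : nat) (i j : 'I_n.-1) : bool := (i.+1 < j)%N || (j.+1 < i)%N.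

Inductive ub_rel (n : nat) : word (ub_gen n) -> word (ub_gen n) -> Prop :=
| ub_sigma_comm (i j : 'I_n.-1) of far i j :
    ub_rel [:: sigma i; sigma j] [:: sigma j; sigma i]
| ub_sigma_braid (i j : 'I_n.-1) of j = i.+1 :> nat :
    ub_rel [:: sigma i; sigma j; sigma i] [:: sigma j; sigma i; sigma j]
| ub_rho_comm (i j : 'I_n.-1) of far i j :
    ub_rel [:: rho i; rho j] [:: rho j; rho i]
| ub_sigma_rho_comm (i j : 'I_n.-1) of far i j :
    ub_rel [:: sigma i; rho j] [:: rho j; sigma i].

Definition UB (n : nat) : groupType := pres_group (@ub_rel n).

(* Main.v *)
Require Import Defs.
From HB Require Import structures.
From mathcomp Require Import all_boot all_classical.
From mathcomp Require Import order ssralg ssrnum ssrint rat archimedean ring zify.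
Set Implicit Arguments.
Unset Strict Implicit.
Unset Printing Implicit Defensive.
Import GRing.Theory Num.Theory.
Local Open Scope classical_set_scope.
Local Open Scope group_scope.

(* For n <= 4 the only pairs of far apart indices are (1, 3) and (3, 1), so
   sending every sigma_i to x |-> 2x, rho_2 to x |-> x + 1 and the other rho_i
   to the identity defines a morphism from UB_n to the group of affine maps
   x |-> 2^k x + t of the rational line. It sends the commutator subgroup to
   translations. The translation parts of finitely many elements have a common
   denominator, but the commutators of the powers of sigma_2 with rho_2 are
   sent to the translations by 1 - 2^-k. *)

Section PresentationMorphism.
Variables (X : choiceType) (G : groupType) (f : X -> G).

Definition letter_eval (l : X * bool) : G := if l.2 then (f l.1)^-1 else f l.1.

Definition word_eval (u : word X) : G := \prod_(l <- u) letter_eval l.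

Lemma word_eval_cong (R : word X -> word X -> Prop) :
  (forall u v, R u v -> word_eval u = word_eval v) ->
  forall u v, pres_cong R u v -> word_eval u = word_eval v.
Proof.
move=> fR u v; elim=> {u v} [|x b|u u' v v' _ eu _ ev| |u v _ ->|v u w _ -> _ ->] //.
  rewrite /word_eval !big_cons !big_nil mulg1.
  by case: b; rewrite /letter_eval /= ?mulVg ?mulgV.
by rewrite /word_eval !big_cat /= -!/(word_eval _) eu ev.
Qed.

(** Universal property of the presentation: evaluation is constant on congruence classes, so
    evaluating a chosen representative gives a morphism. *)
Lemma pres_lift (R : word X -> word X -> Prop) :
  (forall u v, R u v -> word_eval u = word_eval v) ->
  exists phi : UMagmaMorphism.type (pres_group R) G,
    forall u, phi (pres_class R u) = word_eval u.
Proof.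
move=> fR; pose phi (a : pres_group R) := word_eval (repr a).
have phiE u : phi (pres_class R u) = word_eval u.
  exact: (word_eval_cong fR) (pres_repr _ _).
have phiM : monoid.monoid_morphism phi.
  split=> [|a b]; first by rewrite [LHS]phiE /word_eval big_nil.
  by rewrite [LHS]phiE /word_eval big_cat.
pose m := isUMagmaMorphism.Build _ _ phi phiM.
by exists (HB.pack_for (UMagmaMorphism.type (pres_group R) G) phi m).
Qed.

End PresentationMorphism.

Section Commutators.
Variable G : groupType.

Lemma is_subgroup_div (H : set G) :
  H 1 -> (forall x y, H x -> H y -> H (x * y^-1)) -> is_subgroup H.
Proof.
move=> H1 HV; split=> [|x y]; first exact/mem_set.
by move=> /set_mem Hx /set_mem Hy; apply/mem_set/HV.
Qed.

Lemma mem_commutator_subgroup (x y : G) : commutator_subgroup G [~ x, y].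
Proof. by apply: sub_gen_smallest; exists x => //; exists y. Qed.

End Commutators.

(* (k, t) stands for the map x |-> 2^k x + t. *)
Definition dyadic_affine : Type := int * rat.

HB.instance Definition _ := Choice.on dyadic_affine.

Section DyadicAffine.
Local Open Scope ring_scope.
Implicit Types a b : dyadic_affine.

Definition daff_one : dyadic_affine := (0, 0).
(** Composition of affine maps, the right factor being applied first. *)
Definition daff_mul a b : dyadic_affine := (a.1 + b.1, a.2 + 2 ^ a.1 * b.2).
Definition daff_inv a : dyadic_affine := (- a.1, - (2 ^ (- a.1) * a.2)).

Lemma daff_mulA : associative daff_mul.
Proof.
move=> a b c; rewrite /daff_mul /= addrA expfzDr //.
by congr (_, _); ring.
Qed.

Lemma daff_mul1 : left_id daff_one daff_mul.
Proof. by case=> k t; rewrite /daff_mul /= !add0r expr0z mul1r. Qed.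

Lemma daff_mulr1 : right_id daff_one daff_mul.
Proof. by case=> k t; rewrite /daff_mul /= mulr0 !addr0. Qed.

Lemma daff_mulV : left_inverse daff_one daff_inv daff_mul.
Proof. by move=> a; rewrite /daff_mul /= !addNr. Qed.

Lemma daff_mulrV : right_inverse daff_one daff_inv daff_mul.
Proof.
move=> a; rewrite /daff_mul /= mulrN mulrA -expfzDr //.
by rewrite !subrr expr0z mul1r subrr.
Qed.

End DyadicAffine.

HB.instance Definition _ := isGroup.Build dyadic_affine
  daff_mulA daff_mul1 daff_mulr1 daff_mulV daff_mulrV.

Lemma daff_scaleX (k : nat) :
  ((1%R, 0%R) : dyadic_affine) ^+ k = (k%:Z, 0)%R.
Proof.
elim: k => [|k IHk]; first by rewrite expg0.
by rewrite expgS IHk; congr pair.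
Qed.

(** As maps, x is sent to 2^-k (2^k (x + 1) - 1) = x + 1 - 2^-k. *)
Lemma daff_commg_scaleX (k : nat) :
  [~ ((1%R, 0%R) : dyadic_affine) ^+ k, (0%R, 1%R) : dyadic_affine] =
  (0, 1 - 2 ^- k)%R.
Proof.
rewrite daff_scaleX /commg /conjg; congr (_, _) => /=; first by ring.
rewrite -exprnN -exprnP; field; exact: expf_neq0.
Qed.

Lemma common_denominator (s : seq rat) :
  exists2 d : nat, (0 < d)%N & {in s, forall x, (d%:R * x)%R \is a Num.int}.
Proof.
elim: s => [|x s [d d0 ds]]; first by exists 1%N.
have dx : (`|denq x|%N%:R = (denq x)%:~R :> rat)%R.
  by rewrite -[in RHS](gez0_abs (denq_ge0 x)).
(* The witness built by the induction is the product of all denominators. *)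
exists (d * `|denq x|)%N => [|y]; first by rewrite muln_gt0 d0 absz_gt0 denq_neq0.
rewrite inE natrM dx => /predU1P[->|ys].
  by rewrite -mulrA [X in (_ * X)%R]mulrC -numqE rpredM ?natr_int ?intr_int.
by rewrite mulrAC rpredM ?ds ?intr_int.
Qed.

Section AffineQuotient.
Variables (G : groupType) (phi : UMagmaMorphism.type G dyadic_affine).

(** The exponent of 2 is additive with values in an abelian group, so it vanishes on commutators. *)
Lemma commutator_translation (g : G) :
  commutator_subgroup G g -> (phi g).1 = 0%R.
Proof.
move: g; apply: smallest_sub.
  apply: is_subgroup_div => [|x y /= x0 y0]; first by rewrite /= gmulf1.
  by rewrite gmulfM gmulfV /= x0 y0 subr0.
by move=> _ [x _ [y _ <-]]; rewrite /= gmulfR /commg /conjg /=; ring.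
Qed.

Lemma commutator_subgroup_not_fin_gen (a b : G) :
  phi a = (1, 0)%R -> phi b = (0, 1)%R -> ~ fin_gen (commutator_subgroup G).
Proof.
move=> phia phib [S /finite_seqP[s Ss] genS].
have [d d0 ds] := common_denominator [seq (phi x).2 | x <- s].
have int_shift g : commutator_subgroup G g -> (d%:R * (phi g).2)%R \is a Num.int.
  (* The trivial linear part is carried along: among translations the shifts add up, so those with
     shift in (1/d)Z form a subgroup. *)
  move=> G'g; suff [] : (phi g).1 = 0%R /\ (d%:R * (phi g).2)%R \is a Num.int by [].
  move: g G'g; rewrite -genS; apply: smallest_sub.
    apply: is_subgroup_div => [|x y /= [x0 xd] [y0 yd]].
      by rewrite /= gmulf1 mulr0.
    rewrite gmulfM gmulfV /= x0 y0 subr0 oppr0 expr0z !mul1r mulrBr.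
    by rewrite rpredB.
  move=> x Sx; split; last by apply/ds/map_f; rewrite Ss in Sx.
  by apply: commutator_translation; rewrite -genS; apply: sub_gen_smallest.
(* The power [d] is chosen because integrality of d (1 - 2^-d) would make 2^d divide d, while 0 < d
   < 2^d. *)
have := int_shift _ (mem_commutator_subgroup (a ^+ d) b).
rewrite gmulfR gmulfXn phia phib daff_commg_scaleX /= mulrBr mulr1.
rewrite rpredBl ?natr_int // => /intrP[m dm].
have : (d%:Z = m * 2 ^+ d)%R.
  apply: (@intr_inj rat); rewrite rmorphM rmorphXn /= -dm mulfVK //.
  exact: expf_neq0.
move=> /(congr1 absz); rewrite abszM abszX /= => dE.
have := ltn_expl d (isT : 1 < 2)%N; rewrite ltnNge => /negP; apply.
by apply: dvdn_leq => //; rewrite [in X in _ %| X]dE dvdn_mull.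
Qed.

End AffineQuotient.

Lemma UB_commutator_not_fin_gen n :
  (2 < n <= 4)%N -> ~ fin_gen (commutator_subgroup (UB n)).
Proof.
case/andP=> n_gt2 n_le4.
pose f (x : ub_gen n) : dyadic_affine := match x with
  | inl _ => (1, 0)%R
  | inr i => if i == 1%N :> nat then (0, 1)%R else (1 : dyadic_affine)
  end.
(* Indices start at 0, so index 1 is that of rho_2; as n - 1 <= 3, far indices can only be 0 and
   2. *)
have far_neq1 (i j : 'I_n.-1) :
    far i j -> (i != 1%N :> nat) && (j != 1%N :> nat).
  by have := ltn_ord i; have := ltn_ord j; rewrite /far; lia.
have fR u v : ub_rel u v -> word_eval f u = word_eval f v.
  rewrite /word_eval.
  (* The relations among the sigmas hold because all sigmas have the same image; in the other two
     every rho is sent to the identity. *)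
  case=> i j => [_|_|/far_neq1 /andP[/negPf i1 /negPf j1]|/far_neq1 /andP[_ /negPf j1]];
    by rewrite !big_cons !big_nil /letter_eval /= ?i1 ?j1 ?mulg1 ?mul1g.
have [phi phiE] := pres_lift fR.
have i1 : (1 < n.-1)%N by lia.
apply: (@commutator_subgroup_not_fin_gen _ phi
  (pres_class _ [:: sigma (Ordinal i1)]) (pres_class _ [:: rho (Ordinal i1)])).
  by rewrite phiE /word_eval big_seq1.
by rewrite phiE /word_eval big_seq1.
Qed.

Theorem corollary1p3 :
  ~ fin_gen (commutator_subgroup (UB 3)) /\
  ~ fin_gen (commutator_subgroup (UB 4)).
Proof. by split; apply: UB_commutator_not_fin_gen. Qed.
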